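(* Let $n\geqslant 2$ and let $\ell_B,\mathrm{nmaj}\in F(S_n^B)$ be the length and the negative major index. Then $$|\mathrm{Im}(\ell_B+\mathrm{nmaj})|=\begin{cases}5, & \text{if } n=2;\\ 2n^2-1, & \text{otherwise,}\end{cases}$$ and $\mathrm{Im}(\ell_B-\mathrm{nmaj})=\mathrm{Im}(\ell-\mathrm{maj})$, where $\ell,\mathrm{maj}\in F(S_n)$ are the length and the major index of $S_n$.
   Context: $F(W)$ is the set of functions $W\to\mathbb{Z}$ and $\mathrm{Im}(h)$ is the set of values of $h$. $S_n^B$ is the group of bijections $w$ of $[\pm n]=\{-n,\dots,-1,1,\dots,n\}$ with $w(-a)=-w(a)$, written as sequences $(w(1),\dots,w(n))$; it is a Coxeter group with generators $s_0=(-1,2,\dots,n)$ and $s_i=(1,\dots,i-1,i+1,i,i+2,\dots,n)$ for $1\le i\le n-1$, with length $\ell_B$. For a sequence $\sigma=(\sigma(1),\dots,\sigma(n))$ of integers, $\mathrm{maj}(\sigma)=\sum_{i\in[n-1],\,\sigma(i)>\sigma(i+1)}i$ and $\mathrm{Neg}(\sigma)=\{i\in[n]:\sigma(i)<0\}$. The negative major index is $\mathrm{nmaj}(\sigma)=\mathrm{maj}(\sigma)-\sum_{i\in\mathrm{Neg}(\sigma)}\sigma(i)$. On $S_n$, $\ell$ is the Coxeter length (number of inversions). *)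

(* Defs.v *)
From HB Require Import structures.
From mathcomp Require Import all_boot all_order all_fingroup all_algebra.
From mathcomp Require Import finmap.

Set Implicit Arguments.
Unset Strict Implicit.
Unset Printing Implicit Defensive.

Import Order.TTheory GRing.Theory Num.Theory.
Local Open Scope ring_scope.

(* Im(h) for h : W -> Z, where W is a subset of a finite type on which h is
   defined. *)
Definition value_set (T : finType) (W : {set T}) (h : T -> int) : {fset int} :=
  [fset h w | w in W]%fset.

Section WordLength.
Local Open Scope group_scope.
Variables (gT : finGroupType) (S : {set gT}).

Lemma gen_word w : w \in <<S>> -> exists k, w \in S ^+ k.
Proof.
case/gen_prodgP=> k [c Sc ->]; exists k.
elim: k c Sc => [|k IH] c Sc; first by rewrite big_ord0 expg0 set11.
by rewrite big_ord_recl expgS mem_mulg // IH.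
Qed.

(* The least k such that w is a product of k elements of S; here S ^+ k is the
   k-fold elementwise product of the set S. This is the Coxeter length when S is
   a set of Coxeter generators: these are involutions, so inverses are not
   needed. The value 0 outside the subgroup generated by S is a dummy. *)
Definition word_length (w : gT) : nat :=
  if decP (@idP (w \in <<S>>)) is left Sw then ex_minn (gen_word Sw) else 0%N.

Lemma word_lengthP w : w \in <<S>> ->
  w \in S ^+ word_length w /\
  (forall k, w \in S ^+ k -> word_length w <= k)%N.
Proof.
move=> Sw; rewrite /word_length; case: decP => // Sw'.
by case: ex_minnP.
Qed.

End WordLength.

(* The entry sigma(i) of the sequence sigma = (sigma(1), ..., sigma(n)) is
   s`_i.-1. *)
Definition seq_maj (s : seq int) : int :=
  \sum_(1 <= i < size s | s`_i < s`_i.-1) i%:Z.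

Definition seq_nmaj (s : seq int) : int :=
  seq_maj s - \sum_(0 <= i < size s | s`_i < 0) s`_i.

(* 'I_n is 0-based: i : 'I_n stands for i + 1 in [n]. *)
Definition perm_seq n (w : 'S_n) : seq int := [seq (w i).+1%:Z | i <- enum 'I_n].

Definition gens_S n : {set 'S_n} :=
  [set s : 'S_n | [exists i : 'I_n, exists j : 'I_n,
              (j == i.+1 :> nat) && (s == tperm i j)]].

Definition length_S n (w : 'S_n) : int := (word_length (gens_S n) w)%:Z.

Definition maj_S n (w : 'S_n) : int := seq_maj (perm_seq w).

(* [+-n] = {-n, ..., -1, 1, ..., n}: the pair (b, i) stands for the integer
   i + 1 if b = false, and for - (i + 1) if b = true. *)
Definition pm n : finType := (bool * 'I_n)%type.

Definition pm_int n (a : pm n) : int := (-1) ^+ a.1 * a.2.+1%:Z.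

Definition pm_opp n (a : pm n) : pm n := (~~ a.1, a.2).

Lemma pm_int_opp n (a : pm n) : pm_int (pm_opp a) = - pm_int a.
Proof. by case: a => [[] i]; rewrite /pm_int /= ?expr1 ?mulN1r ?opprK ?mul1r. Qed.

Lemma pm_int_inj n : injective (@pm_int n).
Proof.
move=> [b i] [c j]; rewrite /pm_int /=.
case: b; case: c; rewrite ?expr1 ?expr0 ?mulN1r ?mul1r // => - [] eq_ij;
  by congr pair; apply: val_inj.
Qed.

Lemma pm_int_image n (x : int) :
  (exists a : pm n, pm_int a = x) <-> (x != 0) && (`|x| <= n%:Z).
Proof.
split=> [[[[] i] <-]|].
- by rewrite /pm_int /= expr1 mulN1r normrN; apply: ltn_ord.
- by rewrite /pm_int /= mul1r; apply: ltn_ord.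
case: x => [[|k]|k] //= lt_kn.
  by exists (false, Ordinal (lt_kn : (k < n)%N)); rewrite /pm_int /= mul1r.
by exists (true, Ordinal (lt_kn : (k < n)%N)); rewrite /pm_int /= mulN1r NegzE.
Qed.

Definition SB_set n : {set {perm pm n}} :=
  [set w : {perm pm n} | [forall a, w (pm_opp a) == pm_opp (w a)]].

Lemma SB_group_set n : group_set (SB_set n).
Proof.
apply/group_setP; split=> [|u v]; rewrite ?inE.
  by apply/forallP => a; rewrite !perm1.
move=> /forallP uP /forallP vP; apply/forallP => a.
by rewrite !permM (eqP (uP a)).
Qed.

Definition SB n : {group {perm pm n}} := Group (SB_group_set n).

Definition signed_seq n (w : {perm pm n}) : seq int :=
  [seq pm_int (w (false, i)) | i <- enum 'I_n].

(* s_0 exchanges 1 and -1; s_i exchanges i and i + 1, as well as -i and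
   -(i + 1). *)
Definition gens_B n : {set {perm pm n}} :=
  [set s : {perm pm n} | [exists i : 'I_n,
              (i == 0%N :> nat) && (s == tperm (false, i) (true, i))]]
  :|: [set s : {perm pm n} | [exists i : 'I_n, exists j : 'I_n,
              (j == i.+1 :> nat)
              && (s == tperm (false, i) (false, j)
                       * tperm (true, i) (true, j))%g]].

Definition length_B n (w : {perm pm n}) : int :=
  (word_length (gens_B n) w)%:Z.

Definition nmaj_B n (w : {perm pm n}) : int := seq_nmaj (signed_seq w).

(* Main.v *)
Require Import Defs.
From mathcomp Require Import all_boot all_order all_fingroup all_algebra.
From mathcomp Require Import finmap.
From mathcomp Require Import zify.
Import Order.TTheory GRing.Theory Num.Theory.
Local Open Scope ring_scope.

(** The one-line notation of a signed permutation is read as a function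
    'I_n -> int, its entry function.  The length of S_n is the number of
    inversions, and the length of S_n^B is the number of inversions plus the
    sum N of the absolute values of the negative entries.  As nmaj is maj + N,
    this gives
      l_B - nmaj = inv - maj      and      l_B + nmaj = inv + maj + 2 N.

    Both inv and maj are weighted counts of the pairs i < j with g j < g i, so
    they depend only on the relative order of the entries, that is, on the
    standardization of the sequence.  The standardization (any element of S_n)
    and the set of negative values (any subset of [n]) can be prescribed
    independently, see [signed_perm_exists].  The equality of the images of
    l_B - nmaj and l - maj follows at once.

    For the sum, let V = inv + maj + 2 N.  Changing all signs turns inversions
    into non-inversions, hence V(w) + V(-w) = 2 n^2 [stat_sum_opp], and it is
    enough to find the values of V up to n^2.  Taking increasing sequences gives
    all even numbers 2 N, since every integer up to n(n+1)/2 is the sum of a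
    subset of [n].  The value 1 is impossible, because inv and maj vanish
    together [inv_maj_neq1].  When n >= 3, the sequences ordered like
    (1, 3, 2, 4, ..., n) have inv = 1 and maj = 2, which gives all odd numbers
    from 3 on.  Hence the values are those of 0, ..., 2 n^2 except 1 and
    2 n^2 - 1.  When n = 2, inv = maj and V takes the even values only. *)

(** * Word length *)

(** A criterion for recognizing word length: a function that vanishes at 1 and
    grows by at most one under each generator is a lower bound, and
    if it can always be decreased by an involutive generator then descending
    along it spells a word of that length. *)
Lemma word_length_eq (gT : finGroupType) (S : {set gT}) (G : {group gT})
    (f : gT -> nat) :
    S \subset G -> f 1%g = 0%N ->
    (forall s w, s \in S -> w \in G -> (f (s * w)%g <= (f w).+1)%N) ->
    (forall w, w \in G -> w != 1%g ->
       exists s, [/\ s \in S, (s * s = 1)%g & ((f (s * w)%g).+1 = f w)%N]) ->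
  forall w, w \in G -> word_length S w = f w.
Proof.
move=> sSG f1 f_le f_desc.
have f_min k w : w \in (S ^+ k)%g -> w \in G /\ (f w <= k)%N.
  elim: k w => [|k IH] w; first by rewrite expg0 => /set1P->; rewrite f1.
  rewrite expgS => /mulsgP[s v Ss /IH[Gv le_k] ->].
  split; first by rewrite groupM // (subsetP sSG).
  exact: leq_trans (f_le _ _ Ss Gv) _.
have f_word k w : w \in G -> f w = k -> w \in (S ^+ k)%g.
  elim: k w => [|k IH] w Gw fw.
    have [-> | /(f_desc _ Gw)[s [_ _]]] := eqVneq w 1%g.
      by rewrite expg0 set11.
    by rewrite fw.
  have [w1 | /(f_desc _ Gw)[s [Ss ss fsw]]] := eqVneq w 1%g.
    by rewrite w1 f1 in fw.
  have -> : w = (s * (s * w))%g by rewrite mulgA ss mul1g.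
  rewrite expgS mem_mulg //; apply: IH; first by rewrite groupM // (subsetP sSG).
  by move: fsw; rewrite fw => -[].
move=> w Gw; have Sfw := f_word _ _ Gw erefl.
have genw : w \in <<S>>%g.
  move: (f w) Sfw => k; elim: k w {Gw} => [|k IH] w.
    by rewrite expg0 => /set1P->; rewrite group1.
  rewrite expgS => /mulsgP[s v Ss /IH Sv ->].
  by rewrite groupM // mem_gen.
have [Sl l_min] := word_lengthP genw.
by apply/eqP; rewrite eqn_leq l_min //=; case: (f_min _ _ Sl).
Qed.

(** * Inversions and major index as weighted inversion counts *)

Section Statistics.
Variable n : nat.
Implicit Types (c : 'I_n -> 'I_n -> nat) (g h : 'I_n -> int) (p : 'I_n -> 'I_n).

(** A common form of inv and maj, so that dependence on the relative order only
    and behaviour under change of signs are proved for both at once. *)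
Definition winv c g : nat :=
  (\sum_(i < n) \sum_(j < n | i < j) c i j * (g j < g i)%R)%N.

Definition inv_weight (i j : 'I_n) : nat := 1.
(** Only the pairs of adjacent positions count; the 0-based j is the 1-based
    position of the left entry of the pair. *)
Definition maj_weight (i j : 'I_n) : nat := ((j == i.+1 :> nat) * j)%N.

Definition inv g := winv inv_weight g.
Definition maj g := winv maj_weight g.

Lemma eq_winv c g h :
  (forall i j, (g i < g j) = (h i < h j)) -> winv c g = winv c h.
Proof.
by move=> gh; apply: eq_bigr => i _; apply: eq_bigr => j _; rewrite gh.
Qed.

(** Each pair of positions is an inversion for exactly one of g and - g. *)
Lemma winv_opp c g : injective g ->
  (winv c g + winv c (fun i => - g i) = \sum_(i < n) \sum_(j < n | i < j) c i j)%N.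
Proof.
move=> g_inj; rewrite -big_split; apply: eq_bigr => i _.
rewrite -big_split; apply: eq_bigr => j lt_ij /=.
rewrite ltrN2 -mulnDr.
have : g i != g j by apply: contraTneq lt_ij => /g_inj->; rewrite ltnn.
by case: (ltgtP (g i) (g j)) => //; rewrite muln1.
Qed.

Lemma sum_ltn_ord (m : nat) : (m <= n)%N -> (\sum_(k < n) (k < m) = m)%N.
Proof.
move=> le_mn; transitivity (\sum_(k < n | (k < m)%N) 1)%N.
  by rewrite [RHS]big_mkcond; apply: eq_bigr => k _; case: ltnP.
by rewrite -(big_ord_widen n (fun=> 1%N) le_mn) sum1_card card_ord.
Qed.

(** An injection of 'I_n into itself is a permutation, so every value below m
    is taken exactly once. *)
Lemma sum_ltn_inj p (m : nat) : injective p -> (m <= n)%N ->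
  (\sum_i (p i < m) = m)%N.
Proof.
move=> p_inj le_mn; rewrite -[RHS](sum_ltn_ord m le_mn) [RHS](reindex_inj p_inj).
by [].
Qed.

Lemma sum_inv_weight : (\sum_(i < n) \sum_(j < n | i < j) inv_weight i j
  = \sum_(j < n) j)%N.
Proof.
rewrite (exchange_big_dep xpredT) //=; apply: eq_bigr => j _.
by rewrite -[RHS](sum_ltn_ord j (ltnW (ltn_ord j))) big_mkcond.
Qed.

Lemma sum_maj_weight : (\sum_(i < n) \sum_(j < n | i < j) maj_weight i j
  = \sum_(j < n) j)%N.
Proof.
rewrite (exchange_big_dep xpredT) //=; apply: eq_bigr => -[[|m] lt_mn] _.
  by rewrite big1.
rewrite (bigD1 (Ordinal (ltnW lt_mn))) //= big1 /maj_weight /= => [|i].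
  by rewrite eqxx mul1n addn0.
by case/andP=> _; rewrite -val_eqE /= eqSS eq_sym => /negPf->.
Qed.

Lemma nth_map_enum g (i : 'I_n) : [seq g j | j <- enum 'I_n]`_i = g i.
Proof. by rewrite (nth_map i) ?size_enum_ord // nth_ord_enum. Qed.

Lemma seq_majE g : seq_maj [seq g i | i <- enum 'I_n] = (maj g)%:Z.
Proof.
rewrite /seq_maj size_map size_enum_ord; set s := map _ _.
(* The index 0 may be added: it would be compared with itself. *)
transitivity (\sum_(0 <= i < n | s`_i < s`_i.-1) i%:Z).
  have [-> | n_gt0] := posnP n; first by rewrite !big_geq.
  by rewrite [RHS]big_ltn_cond //= ltxx.
rewrite big_mkord /maj /winv (exchange_big_dep xpredT) //= (raddf_sum Posz).
rewrite big_mkcond; apply: eq_bigr => -[[|m] lt_mn] _ /=.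
  by rewrite ltxx big1.
rewrite (bigD1 (Ordinal (ltnW lt_mn))) //= [X in (_ + X)%N]big1; last first.
  move=> i /andP[_]; rewrite /maj_weight -val_eqE /= eqSS eq_sym => /negPf->.
  by rewrite !mul0n.
rewrite /maj_weight /= eqxx mul1n addn0.
rewrite (nth_map_enum g (Ordinal lt_mn)) (nth_map_enum g (Ordinal (ltnW lt_mn))).
by case: ifP; rewrite ?muln1 ?muln0.
Qed.

Lemma adjacent_tperm_ltn (i j a b : 'I_n) : j = i.+1 :> nat ->
  (tperm i j a < tperm i j b)%N
    = ((a, b) == (j, i)) || ((a, b) != (i, j)) && (a < b)%N.
Proof.
move=> ij; rewrite !xpair_eqE -!val_eqE /=.
case: tpermP => [->|->|/eqP + /eqP]; case: tpermP => [->|->|/eqP + /eqP];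
  rewrite -?val_eqE /=; lia.
Qed.

(** Swapping adjacent positions i and j permutes the pairs of positions and keeps
    their orientation, except for the pair (i, j) itself. *)
Lemma inv_tperm g (i j : 'I_n) : j = i.+1 :> nat ->
  (inv (fun a => g (tperm i j a)) + (g j < g i)%R = inv g + (g i < g j)%R)%N.
Proof.
move=> ij; rewrite /inv /winv /inv_weight !pair_big_dep /=.
pose t (q : 'I_n * 'I_n) := (tperm i j q.1, tperm i j q.2).
have t_inv : involutive t by case=> a b; rewrite /t /= !tpermK.
rewrite (reindex_inj (inv_inj t_inv)) /=.
rewrite (bigD1 (j, i)) /= ?tpermL ?tpermR ?ij //.
rewrite [in RHS](bigD1 (i, j)) /= ?ij //.
rewrite tpermL !mul1n.
have swap_ends (a b s s' : nat) : s = s' -> (a + s + b = b + s' + a)%N by lia.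
apply: swap_ends.
apply: eq_big => [[a b]|[a b] _] /=; last by rewrite !tpermK.
have : ~~ (((a, b) == (j, i)) && (a < b)%N).
  by apply/negP=> /andP[/eqP[-> ->]]; rewrite ij ltnNge leqnSn.
rewrite (adjacent_tperm_ltn _ _ a b ij).
by case: ((a, b) == (j, i)); case: ((a, b) == (i, j)); case: (a < b)%N.
Qed.

Lemma inv_tperm_le g (i j : 'I_n) : j = i.+1 :> nat ->
  (inv (fun a => g (tperm i j a)) <= (inv g).+1)%N.
Proof.
move=> ij; apply: leq_trans (leq_addr (g j < g i)%R _) _.
by rewrite inv_tperm // -addn1 leq_add2l leq_b1.
Qed.

Lemma inv_tperm_descent g (i j : 'I_n) : j = i.+1 :> nat -> g j < g i ->
  (inv (fun a => g (tperm i j a))).+1 = inv g.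
Proof.
move=> ij lt_ji; have := inv_tperm g i j ij.
by rewrite lt_ji [g i < _]ltNge (ltW lt_ji) addn1 addn0.
Qed.

Lemma ascents_increasing g :
    (forall i j : 'I_n, j = i.+1 :> nat -> g i < g j) ->
  forall i j : 'I_n, (i < j)%N -> g i < g j.
Proof.
move=> g_asc i [j lt_jn] /=; elim: j lt_jn => // j IH lt_jn.
rewrite ltnS leq_eqVlt => /orP[/eqP ij | lt_ij].
  by apply: g_asc; rewrite /= ij.
apply: (lt_trans (IH (ltnW lt_jn) lt_ij)); exact: g_asc.
Qed.

Lemma descent_or_increasing g : injective g ->
  (exists i j : 'I_n, j = i.+1 :> nat /\ g j < g i)
  \/ (forall i j : 'I_n, (i < j)%N -> g i < g j).
Proof.
move=> g_inj.
have [/existsP[i /existsP[j /andP[/eqP ij lt_ji]]] | no_desc] :=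
    boolP [exists i : 'I_n, exists j : 'I_n, (j == i.+1 :> nat) && (g j < g i)].
  by left; exists i, j.
right; apply: ascents_increasing => i j ij.
case: (ltgtP (g i) (g j)) => // [lt_ji | /g_inj eq_ij].
  by case/existsP: no_desc; exists i; apply/existsP; exists j; rewrite ij eqxx.
by move: ij; rewrite eq_ij => /n_Sn.
Qed.

(** p i counts the j with p j < p i, which are the j < i. *)
Lemma increasing_ord_id p : (forall i j : 'I_n, (i < j)%N -> (p i < p j)%N) ->
  forall i, p i = i.
Proof.
move=> p_incr i.
have p_lt a b : (p a < p b)%N = (a < b)%N.
  case: (ltngtP a b) => [/p_incr-> // | /p_incr lt_ba | /val_inj->].
    by rewrite ltnNge ltnW.
  by rewrite ltnn.
have p_inj : injective p.
  by move=> a b eq_ab; case: (ltngtP a b) => [/p_incr|/p_incr|/val_inj //];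
    rewrite eq_ab ltnn.
apply: val_inj; rewrite /= -[LHS](sum_ltn_inj p (p i) p_inj (ltnW (ltn_ord _))).
rewrite (eq_bigr (fun j : 'I_n => (j < i) : nat)) ?sum_ltn_ord // 1?ltnW //.
by move=> j _; rewrite p_lt.
Qed.

Lemma inv_eq0 g : (inv g == 0)%N -> maj g = 0%N.
Proof.
rewrite sum_nat_eq0 => /forallP inv0.
apply/eqP; rewrite sum_nat_eq0; apply/forallP => i; apply/implyP => _.
rewrite sum_nat_eq0; apply/forallP => j; apply/implyP => ij.
have := inv0 i; rewrite /= sum_nat_eq0 => /forallP/(_ j).
by rewrite ij /inv_weight mul1n /= => /eqP->; rewrite muln0.
Qed.

Lemma maj_eq0 g : injective g -> maj g = 0%N -> inv g = 0%N.
Proof.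
move=> g_inj /eqP; rewrite sum_nat_eq0 => /forallP maj0.
have [[i [j [ij lt_ji]]] | g_incr] := descent_or_increasing g g_inj.
  have := maj0 i; rewrite /= sum_nat_eq0 => /forallP/(_ j).
  by rewrite /maj_weight ij ltnSn eqxx lt_ji.
rewrite /inv /winv big1 // => i _; rewrite big1 // => j /g_incr lt_ij.
by rewrite [g j < _]ltNge (ltW lt_ij).
Qed.

(** A sequence without descents has no inversion either, so inv and maj are both
    zero or both positive. *)
Lemma inv_maj_neq1 g : injective g -> (inv g + maj g)%N != 1%N.
Proof.
move=> g_inj; have [inv0 | inv_gt0] := posnP (inv g).
  by rewrite inv0 inv_eq0 ?inv0.
have [/(maj_eq0 g g_inj) inv0 | ] := posnP (maj g); first by rewrite inv0 in inv_gt0.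
by case: (inv g) (maj g) inv_gt0 => [|k] [|l] // _ _; rewrite addSn addnS.
Qed.

Definition rank g i : nat := (\sum_j (g j < g i)%R)%N.

Lemma rank_lt g i : (rank g i < n)%N.
Proof.
rewrite /rank (bigD1 i) //= ltxx add0n.
rewrite -[X in (_ < X)%N](card_ord n) -sum1_card.
rewrite [X in (_ < X)%N](bigD1 i) //= add1n ltnS.
by apply: leq_sum => j _; apply: leq_b1.
Qed.

Lemma rank_mono g : injective g ->
  forall i j, (rank g i < rank g j)%N = (g i < g j).
Proof.
move=> g_inj.
have lt_rank i j : g i < g j -> (rank g i < rank g j)%N.
  move=> lt_ij; rewrite /rank [X in (_ < X)%N](bigD1 i) //= (bigD1 i) //=.
  rewrite ltxx lt_ij add0n add1n ltnS; apply: leq_sum => k _.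
  by case: (ltP (g k) (g i)) => // /lt_trans->.
move=> i j; case: (ltgtP (g i) (g j)) => [/lt_rank-> // | /lt_rank lt_ji | /g_inj->].
  by rewrite ltnNge ltnW.
by rewrite ltnn.
Qed.

(** The permutation that sends i to the rank of its entry. *)
Lemma standardization g : injective g ->
  exists s : 'S_n, forall i j, (s i < s j)%N = (g i < g j).
Proof.
move=> g_inj; pose r i := Ordinal (rank_lt g i).
have r_inj : injective r.
  move=> i j [eq_r]; case: (ltgtP (g i) (g j)) => [||/g_inj //];
    by rewrite -(rank_mono g g_inj) eq_r ltnn.
by exists (perm r_inj) => i j; rewrite !permE rank_mono.
Qed.

Definition perm_entry (s : 'S_n) (i : 'I_n) : int := (s i).+1%:Z.

Lemma perm_entry_inj s : injective (perm_entry s).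
Proof. by move=> i j [/val_inj/perm_inj]. Qed.

Lemma perm_entry_tperm s i j :
  inv (perm_entry (tperm i j * s)%g) = inv (fun a => perm_entry s (tperm i j a)).
Proof. by apply: eq_winv => a b; rewrite /perm_entry !permM. Qed.

(** Multiplying by tperm i j on the left swaps the entries in positions i and j,
    because products of permutations apply the left factor first. *)
Lemma length_SE s : length_S s = (inv (perm_entry s))%:Z.
Proof.
congr Posz; apply: (word_length_eq _ _ [group of [set: 'S_n]]
  (fun u : 'S_n => inv (perm_entry u))).
- exact: subsetT.
- rewrite /inv /winv big1 // => i _; rewrite big1 // => j lt_ij.
  by rewrite /perm_entry !perm1 ltz_nat ltnS ltnNge ltnW.
- move=> t w; rewrite inE => /existsP[i /existsP[j /andP[/eqP ij /eqP->]]] _.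
  by rewrite perm_entry_tperm inv_tperm_le.
- move=> w _ w_neq1.
  have [[i [j [ij lt_ji]]] | w_incr] :=
    descent_or_increasing (perm_entry w) (perm_entry_inj w).
    exists (tperm i j); split; last 1 first.
    + by rewrite perm_entry_tperm inv_tperm_descent.
    + rewrite inE; apply/existsP; exists i; apply/existsP; exists j.
      by rewrite ij !eqxx.
    + by rewrite tperm2.
  case/eqP: w_neq1; apply/permP => i; rewrite perm1.
  exact: (increasing_ord_id (fun a => w a)).
- by rewrite inE.
Qed.

End Statistics.

(** * The length of signed permutations *)

Section SignedPermutations.
Variable n : nat.
Implicit Types (g : 'I_n -> int) (w : {perm pm n}).

Definition neg_sum g : nat := (\sum_i (g i < 0)%R * `|g i|)%N.

Definition signed_inv g : nat := (inv n g + neg_sum g)%N.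

Lemma eq_signed_inv g h : g =1 h -> signed_inv g = signed_inv h.
Proof.
move=> gh; congr addn; first by apply: eq_winv => i j; rewrite !gh.
by apply: eq_bigr => i _; rewrite gh.
Qed.

Definition flip (i0 : 'I_n) g (i : 'I_n) : int := if i == i0 then - g i else g i.

Lemma flipK i0 g : flip i0 (flip i0 g) =1 g.
Proof. by move=> i; rewrite /flip; case: eqP => // _; rewrite opprK. Qed.

(** Let a > 0 be the first entry.  Making it negative adds a to the sum of the
    negative entries and removes the inversions of the first position with the
    entries strictly between - a and a; there are a - 1 of them since the
    absolute values of the entries form a permutation of [n]. *)
Lemma signed_inv_flip (i0 : 'I_n) g (p : 'I_n -> 'I_n) :
    i0 = 0%N :> nat -> injective p -> (forall i, `|g i|%N = (p i).+1) ->
  0 < g i0 -> signed_inv (flip i0 g) = (signed_inv g).+1.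
Proof.
move=> i0_0 p_inj gp gi0_gt0.
have gi0 : g i0 = (p i0).+1%:Z by rewrite -gp; lia.
have not_i0 (j : 'I_n) : (j != i0) = (i0 < j)%N.
  by rewrite -val_eqE /= i0_0 lt0n.
have row0 : (\sum_(j < n | i0 < j) (g j < g i0)%R
    = \sum_(j < n | i0 < j) (g j < - g i0)%R + p i0)%N.
  rewrite -[in RHS](sum_ltn_inj n p (p i0) p_inj (ltnW (ltn_ord _))).
  rewrite [X in (_ + X)%N](bigD1 i0) //= ltnn add0n.
  rewrite [X in (_ + X)%N](eq_bigl _ _ not_i0) -big_split /=.
  apply: eq_bigr => j lt_0j.
  have pj_neq : (p j != p i0 :> nat).
    by apply: contraTneq lt_0j => /val_inj/p_inj->; rewrite ltnn.
  have gj := gp j; rewrite gi0.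
  case: (ltP (g j)) => ?; case: (ltP (g j)) => ?; case: (ltnP (p j)) => ? //; lia.
have invE h : inv n h = (\sum_(j < n | i0 < j) (h j < h i0)%R
    + \sum_(i < n | i != i0) \sum_(j < n | i < j) (h j < h i)%R)%N.
  rewrite /inv /winv (bigD1 i0) //=; congr addn.
    by apply: eq_bigr => j _; rewrite mul1n.
  by apply: eq_bigr => i _; apply: eq_bigr => j _; rewrite mul1n.
have negE h : neg_sum h
    = ((h i0 < 0)%R * `|h i0| + \sum_(i < n | i != i0) (h i < 0)%R * `|h i|)%N.
  by rewrite /neg_sum (bigD1 i0).
have flip0 : flip i0 g i0 = - g i0 by rewrite /flip eqxx.
have flipN j : j != i0 -> flip i0 g j = g j by rewrite /flip => /negPf->.
rewrite /signed_inv !invE !negE flip0.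
rewrite (eq_bigr (fun j : 'I_n => (g j < - g i0)%R : nat)) => [|j]; last first.
  by rewrite -not_i0 => /flipN->.
rewrite row0.
have -> : (\sum_(i < n | i != i0) \sum_(j < n | i < j) (flip i0 g j < flip i0 g i)%R
    = \sum_(i < n | i != i0) \sum_(j < n | i < j) (g j < g i)%R)%N.
  apply: eq_bigr => i i_neq; apply: eq_bigr => j lt_ij.
  rewrite (flipN i i_neq) flipN // not_i0.
  by rewrite i0_0 (leq_ltn_trans _ lt_ij).
have -> : (\sum_(i < n | i != i0) (flip i0 g i < 0)%R * `|flip i0 g i|
    = \sum_(i < n | i != i0) (g i < 0)%R * `|g i|)%N.
  by apply: eq_bigr => i i_neq; rewrite flipN.
rewrite oppr_lt0 gi0_gt0 ltNge (ltW gi0_gt0) /= abszN gp; lia.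
Qed.

Lemma signed_inv_flip_neg (i0 : 'I_n) g (p : 'I_n -> 'I_n) :
    i0 = 0%N :> nat -> injective p -> (forall i, `|g i|%N = (p i).+1) ->
  g i0 < 0 -> (signed_inv (flip i0 g)).+1 = signed_inv g.
Proof.
move=> i0_0 p_inj gp gi0_lt0.
rewrite -(signed_inv_flip i0 (flip i0 g) p) //; first exact/eq_signed_inv/flipK.
  by move=> i; rewrite /flip; case: eqP => // _; rewrite abszN.
by rewrite /flip eqxx oppr_gt0.
Qed.

Definition entry w (i : 'I_n) : int := pm_int (w (false, i)).

Definition abs_entry w (i : 'I_n) : 'I_n := (w (false, i)).2.

Lemma SB_opp w a : w \in SB n -> w (pm_opp a) = pm_opp (w a).
Proof. by rewrite inE => /forallP/(_ a)/eqP. Qed.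

Lemma absz_entry w i : `|entry w i|%N = (abs_entry w i).+1.
Proof. by rewrite /entry /pm_int abszMsign. Qed.

Lemma entry_inj w : injective (entry w).
Proof. by move=> i j /pm_int_inj/perm_inj[]. Qed.

(** Entries with equal absolute values are equal or opposite, and w maps no two
    positive positions to opposite values since w (- a) = - w a. *)
Lemma abs_entry_inj w : w \in SB n -> injective (abs_entry w).
Proof.
move=> Bw i j eq_ij.
have [eq_b | neq_b] := eqVneq (w (false, i)).1 (w (false, j)).1.
  suff /perm_inj[] : w (false, i) = w (false, j) by [].
  by rewrite [LHS]surjective_pairing [RHS]surjective_pairing eq_b [(_).2]eq_ij.
suff /perm_inj : w (false, i) = w (true, j) by [].
rewrite -[(true, j)]/(pm_opp (false, j)) SB_opp // [LHS]surjective_pairing.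
rewrite /pm_opp; congr pair => //.
by case: (w (false, i)).1 (w (false, j)).1 neq_b => [] [].
Qed.

Lemma tperm_sign_flipE (i0 : 'I_n) (a : pm n) :
  tperm (false, i0) (true, i0) a = (a.1 (+) (a.2 == i0), a.2).
Proof.
case: a => b i /=; have [-> | i_neq] := eqVneq i i0.
  by case: b; rewrite ?tpermL ?tpermR.
by rewrite addbF tpermD // xpair_eqE [i0 == i]eq_sym (negPf i_neq) andbF.
Qed.

Lemma tperm_signed_swapE (i j : 'I_n) (a : pm n) :
  (tperm (false, i) (false, j) * tperm (true, i) (true, j))%g a
    = (a.1, tperm i j a.2).
Proof.
have inj_pair (c : bool) : injective (pair c : 'I_n -> pm n) by move=> k l [].
have other (c : bool) k : tperm (c, i) (c, j) (~~ c, k) = (~~ c, k) :> pm n.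
  by rewrite tpermD // xpair_eqE; case: c.
case: a => [[] k]; rewrite permM /=.
  by rewrite (other false) (inj_tperm _ _ _ (inj_pair true)).
by rewrite -(inj_tperm _ _ _ (inj_pair false)) (other true).
Qed.

Lemma gens_B_sub : gens_B n \subset SB n.
Proof.
apply/subsetP => s; rewrite !inE => /orP[|].
  case/existsP=> i /andP[_ /eqP->]; apply/forallP => a.
  by rewrite !tperm_sign_flipE /pm_opp /= addNb.
case/existsP=> i /existsP[j /andP[_ /eqP->]]; apply/forallP => a.
by rewrite !tperm_signed_swapE.
Qed.

Lemma entry_flip w i0 : w \in SB n ->
  entry (tperm (false, i0) (true, i0) * w)%g =1 flip i0 (entry w).
Proof.
move=> Bw i; rewrite /entry /flip permM tperm_sign_flipE /=.
by case: eqP => // _; rewrite -[(true, i)]/(pm_opp (false, i)) SB_opp ?pm_int_opp.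
Qed.

Lemma entry_swap w i j a :
  entry (tperm (false, i) (false, j) * tperm (true, i) (true, j) * w)%g a
    = entry w (tperm i j a).
Proof. by rewrite /entry permM tperm_signed_swapE. Qed.

Lemma neg_sum_tperm g i j : neg_sum (fun a => g (tperm i j a)) = neg_sum g.
Proof. by rewrite /neg_sum [RHS](reindex_inj (@perm_inj _ (tperm i j))). Qed.

Lemma SB_increasing_id w : w \in SB n -> (forall i, 0 < entry w i) ->
  (forall i j : 'I_n, (i < j)%N -> entry w i < entry w j) -> w = 1%g.
Proof.
move=> Bw w_gt0 w_incr.
have entryE i : entry w i = (abs_entry w i).+1%:Z.
  by have := absz_entry w i; have := w_gt0 i; lia.
have w_id i : w (false, i) = (false, i).
  have abs_id : abs_entry w i = i.
    apply: (increasing_ord_id n (abs_entry w)) => a b /w_incr.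
    by rewrite !entryE ltz_nat.
  have := w_gt0 i; rewrite [w _]surjective_pairing [(_).2]abs_id /entry /pm_int.
  by case: (w _).1; rewrite // mulN1r.
apply/permP => -[[] i]; rewrite perm1 ?w_id //.
by rewrite -[(true, i)]/(pm_opp (false, i)) SB_opp ?w_id.
Qed.

(** A left product by s_0 changes the sign of the first entry, and a left product
    by s_i swaps two adjacent entries.  A sequence with positive
    first entry and without descents is the identity. *)
Lemma length_BE w : (0 < n)%N -> w \in SB n ->
  length_B w = (signed_inv (entry w))%:Z.
Proof.
move=> n_gt0; pose i0 := Ordinal n_gt0.
move=> Bw; congr Posz.
apply: (word_length_eq _ _ (SB n) (fun u => signed_inv (entry u))) => //.
- exact: gens_B_sub.
- rewrite /signed_inv /inv /winv /neg_sum !big1 // => i _.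
    by rewrite /entry perm1.
  rewrite big1 // => j lt_ij; rewrite /entry !perm1 /pm_int /= !mul1r.
  by rewrite ltz_nat ltnS ltnNge ltnW.
- move=> s {}w + {}Bw; rewrite !inE => /orP[|].
    case/existsP=> i /andP[/eqP i_0 /eqP->].
    rewrite (eq_signed_inv _ _ (entry_flip _ _ Bw)).
    have := abs_entry_inj w Bw; have := absz_entry w => abs_w abs_inj.
    case: (ltrP 0 (entry w i)) => [gt0 | le0].
      by rewrite (signed_inv_flip i _ _ i_0 abs_inj abs_w).
    rewrite ltnW // ltnS ltnW // (signed_inv_flip_neg i _ _ i_0 abs_inj abs_w) //.
    by have := abs_w i; lia.
  case/existsP=> i /existsP[j /andP[/eqP ij /eqP->]].
  rewrite (eq_signed_inv _ _ (entry_swap w i j)) /signed_inv neg_sum_tperm.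
  rewrite -addSn leq_add2r.
  exact: inv_tperm_le.
move=> {}w {}Bw w_neq1.
have [[i [j [ij lt_ji]]] | w_incr] :=
    descent_or_increasing n (entry w) (entry_inj w).
  exists (tperm (false, i) (false, j) * tperm (true, i) (true, j))%g; split.
  - rewrite !inE; apply/orP; right.
    by apply/existsP; exists i; apply/existsP; exists j; rewrite ij !eqxx.
  - apply/permP => a; rewrite perm1 permM !tperm_signed_swapE /= tpermK.
    by case: a.
  rewrite (eq_signed_inv _ _ (entry_swap w i j)) /signed_inv neg_sum_tperm -addSn.
  by rewrite inv_tperm_descent.
have [gt0 | le0] := ltrP 0 (entry w i0).
  case/eqP: w_neq1; apply: SB_increasing_id => // i.
  have [-> // | i_neq] := eqVneq i i0; apply: lt_trans gt0 (w_incr _ _ _).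
  by rewrite lt0n.
exists (tperm (false, i0) (true, i0)); split.
- by rewrite !inE; apply/orP; left; apply/existsP; exists i0; rewrite !eqxx.
- by rewrite tperm2.
rewrite (eq_signed_inv _ _ (entry_flip _ _ Bw)).
apply: (signed_inv_flip_neg i0 _ (abs_entry w)) => //; first exact: abs_entry_inj.
  exact: absz_entry.
by have := absz_entry w i0; lia.
Qed.

Lemma nmaj_BE w : nmaj_B w = (maj n (entry w) + neg_sum (entry w))%N%:Z.
Proof.
rewrite /nmaj_B /seq_nmaj [signed_seq w]/[seq entry w i | i <- enum 'I_n].
rewrite seq_majE PoszD; congr (_ + _).
rewrite size_map size_enum_ord big_mkord /neg_sum (raddf_sum Posz) big_mkcond.
rewrite -sumrN; apply: eq_bigr => i _; rewrite nth_map_enum.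
case: ltP => [lt0 | _]; last by rewrite oppr0.
by rewrite mul1n -ltr0_norm // abszE.
Qed.

(** * The values of the sum *)

Definition stat_sum w : nat :=
  (inv n (entry w) + maj n (entry w) + 2 * neg_sum (entry w))%N.

Lemma length_nmaj_sumE w : (0 < n)%N -> w \in SB n ->
  length_B w + nmaj_B w = (stat_sum w)%:Z.
Proof.
move=> n_gt0 Bw; rewrite length_BE // nmaj_BE /signed_inv /stat_sum; lia.
Qed.

Lemma length_nmaj_subE w : (0 < n)%N -> w \in SB n ->
  length_B w - nmaj_B w = (inv n (entry w))%:Z - (maj n (entry w))%:Z.
Proof.
move=> n_gt0 Bw; rewrite length_BE // nmaj_BE /signed_inv; lia.
Qed.

Lemma maj_SE (s : 'S_n) : maj_S s = (maj n (perm_entry n s))%:Z.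
Proof. exact: seq_majE. Qed.

Lemma pm_opp_inj : injective (@pm_opp n).
Proof. by move=> [b i] [c j] [/negb_inj-> ->]. Qed.

Definition neg_one : {perm pm n} := perm pm_opp_inj.

Lemma neg_one_SB : neg_one \in SB n.
Proof. by rewrite inE; apply/forallP => a; rewrite !permE. Qed.

Lemma entry_opp w : entry (w * neg_one)%g =1 (fun i => - entry w i).
Proof. by move=> i; rewrite /entry permM permE pm_int_opp. Qed.

Lemma neg_sum_opp w : w \in SB n ->
  (neg_sum (entry w) + neg_sum (fun i => - entry w i) = \sum_(k < n) k.+1)%N.
Proof.
move=> Bw; rewrite [RHS](reindex_inj (abs_entry_inj w Bw)) -big_split.
apply: eq_bigr => i _ /=; rewrite -absz_entry abszN oppr_lt0 -mulnDl.
have : entry w i != 0 by rewrite -absz_eq0 absz_entry.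
by case: (ltgtP (entry w i) 0); rewrite // mul1n.
Qed.

Lemma sum_square (m : nat) :
  (2 * \sum_(k < m) k + 2 * \sum_(k < m) k.+1 = 2 * m ^ 2)%N.
Proof.
elim: m => [|m IH]; first by rewrite !big_ord0.
rewrite !big_ord_recr /=; move: IH; rewrite -!mulnn.
by move: (\sum_(k < m) k)%N (\sum_(k < m) k.+1)%N => S T; lia.
Qed.

Lemma half_square_le (m k : nat) : (2 * k <= m ^ 2)%N ->
  (k <= \sum_(i < m) i.+1)%N.
Proof.
have : (\sum_(i < m) i <= \sum_(i < m) i.+1)%N by apply: leq_sum.
have := sum_square m.
by move: (\sum_(i < m) i)%N (\sum_(i < m) i.+1)%N (m ^ 2)%N => S T Q; lia.
Qed.

(** Changing all signs exchanges inversions and non-inversions, descents and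
    ascents, negative and positive entries; each of inv and maj contributes
    n(n-1)/2 to the sum, and 2 N contributes n(n+1). *)
Lemma stat_sum_opp w : w \in SB n ->
  (stat_sum w + stat_sum (w * neg_one)%g = 2 * n ^ 2)%N.
Proof.
move=> Bw; rewrite -sum_square -(neg_sum_opp w Bw) /stat_sum.
have := winv_opp n (inv_weight n) _ (entry_inj w).
have := winv_opp n (maj_weight n) _ (entry_inj w).
rewrite sum_inv_weight sum_maj_weight => majE invE.
rewrite [inv n (entry (w * _)%g)](eq_winv n _ _ (fun i => - entry w i)); last first.
  by move=> i j; rewrite !entry_opp.
rewrite [maj n (entry (w * _)%g)](eq_winv n _ _ (fun i => - entry w i)); last first.
  by move=> i j; rewrite !entry_opp.
have -> : neg_sum (entry (w * neg_one)%g) = neg_sum (fun i => - entry w i).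
  by apply: eq_bigr => i _; rewrite entry_opp.
rewrite /inv /maj; lia.
Qed.

Lemma stat_sum_neq1 w : stat_sum w != 1%N.
Proof.
have := inv_maj_neq1 n _ (entry_inj w); rewrite /stat_sum; lia.
Qed.

(** The signs A chosen for the values in [n] determine the set of entries h k;
    arranging them in the relative order given by s is composing s with the
    inverse of the standardization of h. *)
Lemma signed_perm_exists (s : 'S_n) (A : pred nat) :
  exists w, [/\ w \in SB n,
    forall i j, (entry w i < entry w j) = (s i < s j)%N
    & neg_sum (entry w) = (\sum_(k < n | A k) k.+1)%N].
Proof.
pose h (k : 'I_n) : int := (-1) ^+ A k * k.+1%:Z.
have abs_h k : `|h k|%N = k.+1 by rewrite /h abszMsign.
have h_inj : injective h.
  by move=> k l eq_h; apply/val_inj/succn_inj; rewrite /= -!abs_h eq_h.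
have [t tP] := standardization n h h_inj.
pose r : 'S_n := (s * t^-1)%g.
pose f (a : pm n) : pm n := (a.1 (+) A (r a.2), r a.2).
have f_inj : injective f.
  move=> [b i] [c j] [] /= + /perm_inj eq_ij; rewrite eq_ij.
  by move/addIb->.
have entryE i : entry (perm f_inj) i = h (r i) by rewrite /entry permE.
exists (perm f_inj); split.
- by rewrite inE; apply/forallP => a; rewrite !permE /f /pm_opp /= addNb.
- by move=> i j; rewrite !entryE -tP !permM !permKV.
rewrite /neg_sum [RHS](reindex_inj (@perm_inj _ r)) [RHS]big_mkcond.
apply: eq_bigr => i _; rewrite entryE abs_h /h.
by case: (A _); rewrite /= ?mulN1r ?oppr_lt0 ?mul1r ?ltz_nat ?mul1n ?mul0n.
Qed.

Lemma winv_entryE (s : 'S_n) w :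
    (forall i j, (entry w i < entry w j) = (s i < s j)%N) ->
  forall c, winv n c (entry w) = winv n c (perm_entry n s).
Proof. by move=> ws c; apply: eq_winv => i j; rewrite ws. Qed.

Lemma winv_id c : winv n c (perm_entry n 1) = 0%N.
Proof.
rewrite /winv big1 // => i _; rewrite big1 // => j lt_ij.
by rewrite /perm_entry !perm1 ltz_nat ltnS ltnNge ltnW ?muln0.
Qed.

Lemma winv_adjacent c (i j : 'I_n) : j = i.+1 :> nat ->
  winv n c (perm_entry n (tperm i j)) = c i j.
Proof.
move=> ij; rewrite /winv pair_big_dep /= (bigD1 (i, j)) /= ?ij //.
rewrite /perm_entry tpermL tpermR !ltz_nat !ltnS ij leqnn muln1 big1 ?addn0 //.
move=> [a b] /= /andP[lt_ab ab_neq]; rewrite ltz_nat ltnS.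
by rewrite ltnNge ltnW ?muln0 // adjacent_tperm_ltn // lt_ab ab_neq orbT.
Qed.

(** Greedy choice: use the largest summand m only when the smaller ones do not
    suffice. *)
Lemma subset_sum (m k : nat) : (k <= \sum_(i < m) i.+1)%N ->
  exists A : pred nat, (\sum_(i < m | A i) i.+1 = k)%N.
Proof.
elim: m k => [|m IH] k.
  by rewrite big_ord0 leqn0 => /eqP->; exists pred0; rewrite big_ord0.
rewrite big_ord_recr /= => le_k.
have m_le : (m <= \sum_(i < m) i.+1)%N.
  by rewrite -[X in (X <= _)%N](card_ord m) -sum1_card leq_sum.
have [le_k' | gt_k] := leqP k (\sum_(i < m) i.+1).
  have [A Ak] := IH k le_k'; exists (fun i => A i && (i < m)%N).
  rewrite big_mkcond big_ord_recr /= ltnn andbF addn0 -[RHS]Ak [RHS]big_mkcond.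
  by apply: eq_bigr => i _; rewrite ltn_ord andbT.
have [A Ak] : exists A : pred nat, (\sum_(i < m | A i) i.+1 = k - m.+1)%N.
  by apply: IH; move: (\sum_(i < m) i.+1)%N le_k m_le gt_k => T; lia.
have k_gt : (m < k)%N by apply: leq_ltn_trans gt_k.
exists (fun i => A i || (i == m)).
rewrite big_mkcond big_ord_recr /= eqxx orbT.
have -> : k = (k - m.+1 + m.+1)%N by lia.
congr addn; rewrite -[RHS]Ak [RHS]big_mkcond; apply: eq_bigr => i _.
by rewrite ltn_eqF ?orbF.
Qed.

Lemma stat_sum_even (k : nat) : (2 * k <= n ^ 2)%N ->
  exists2 w, w \in SB n & stat_sum w = (2 * k)%N.
Proof.
move=> le_k; have [|A Ak] := subset_sum n k.
  exact: half_square_le.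
have [w [Bw ws wneg]] := signed_perm_exists 1 A.
exists w => //; rewrite /stat_sum /inv /maj !(winv_entryE _ w ws) !winv_id wneg.
by rewrite Ak.
Qed.

Lemma stat_sum_odd (k : nat) : (2 < n)%N -> (2 * k <= n ^ 2)%N ->
  exists2 w, w \in SB n & stat_sum w = (2 * k + 3)%N.
Proof.
move=> n_gt2 le_k; have [|A Ak] := subset_sum n k.
  exact: half_square_le.
(* Positions 2 and 3 in 1-based numbering. *)
pose i1 := Ordinal (ltnW n_gt2); pose i2 := Ordinal n_gt2.
have [w [Bw ws wneg]] := signed_perm_exists (tperm i1 i2) A.
exists w => //; rewrite /stat_sum /inv /maj !(winv_entryE _ w ws).
by rewrite !winv_adjacent // wneg Ak /inv_weight /maj_weight /=; lia.
Qed.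

(** Values up to n^2 are constructed directly, larger ones by changing all
    signs. *)
Lemma stat_sum_range (k : nat) : (2 < n)%N ->
  (exists2 w, w \in SB n & stat_sum w = k)
  <-> [/\ k != 1, k.+1 != 2 * n ^ 2 & k <= 2 * n ^ 2]%N.
Proof.
move=> n_gt2; split=> [[w Bw <-] | [k_neq1 k_neq k_le]].
  have := stat_sum_opp w Bw; have := stat_sum_neq1 w.
  have := stat_sum_neq1 (w * neg_one)%g.
  move: (stat_sum w) (stat_sum _) (2 * n ^ 2)%N => a b q b1 a1 ab.
  by split; lia.
have small m : m != 1%N -> (m <= n ^ 2)%N ->
    exists2 w, w \in SB n & stat_sum w = m.
  move=> m_neq1 m_le; have m_eq := odd_double_half m.
  case m_odd: (odd m) in m_eq.
    have [|w Bw wE] := stat_sum_odd (m./2 - 1) n_gt2; first lia.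
    by exists w => //; lia.
  have [|w Bw wE] := stat_sum_even m./2; first lia.
  by exists w => //; lia.
have [k_small | k_large] := leqP k (n ^ 2); first exact: small.
have [||w Bw wE] := small (2 * n ^ 2 - k)%N; [lia.. |].
exists (w * neg_one)%g; first by rewrite groupM // neg_one_SB.
by apply: (@addnI (stat_sum w)); rewrite stat_sum_opp // wE subnK.
Qed.

(** The only possible inversion is a descent at position 1, so inv = maj. *)
Lemma stat_sum_range_dim2 (k : nat) : n = 2%N ->
  (exists2 w, w \in SB n & stat_sum w = k) <-> ~~ odd k && (k <= 8)%N.
Proof.
move=> n_eq2; split=> [[w Bw <-] | /andP[k_even k_le]].
  have -> : ~~ odd (stat_sum w).
    have -> : stat_sum w = (signed_inv (entry w)).*2.
      rewrite /stat_sum (_ : maj n (entry w) = inv n (entry w)) /signed_inv; first lia.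
      apply: eq_bigr => i _; apply: eq_bigr => j lt_ij.
      rewrite /maj_weight /inv_weight; congr muln.
      have := ltn_ord j; rewrite [X in (_ < X)%N]n_eq2; case: eqP; lia.
    by rewrite odd_double.
  have -> : (8 = 2 * n ^ 2)%N by rewrite n_eq2.
  by rewrite -(stat_sum_opp w Bw) leq_addr.
have k_eq := odd_double_half k; rewrite (negPf k_even) in k_eq.
have [k_small | k_large] := leqP k 4.
  have [|w Bw wE] := stat_sum_even k./2; first by rewrite n_eq2; lia.
  by exists w => //; lia.
have [|w Bw wE] := stat_sum_even (4 - k./2)%N; first by rewrite n_eq2; lia.
exists (w * neg_one)%g; first by rewrite groupM // neg_one_SB.
apply: (@addnI (stat_sum w)); rewrite stat_sum_opp // wE.
by rewrite [X in (X ^ _)%N]n_eq2; lia.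
Qed.

End SignedPermutations.

(** * Counting *)

Lemma card_value_set (T : finType) (W : {set T}) (h : T -> int) (ks : seq nat) :
    uniq ks -> (forall w, w \in W -> exists2 k, k \in ks & h w = k%:Z) ->
    (forall k, k \in ks -> exists2 w, w \in W & h w = k%:Z) ->
  #|` value_set W h|%fset = size ks.
Proof.
move=> ks_uniq hW Wh.
have -> : value_set W h = [fset x in [seq k%:Z | k <- ks]]%fset.
  apply/fsetP => x; rewrite !inE; apply/imfsetP/mapP => [[w /= Ww ->] | [k ks_k ->]].
    exact: hW.
  by have [w Ww <-] := Wh k ks_k; exists w.
rewrite card_fseq undup_id ?size_map // map_inj_uniq // => k l [].
by [].
Qed.

Theorem proposition5p4 (n : nat) (hn : (2 <= n)%N) :
  #|` value_set (SB n) (@length_B n \+ @nmaj_B n) |%fset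
    = (if n == 2%N then 5 else 2 * n ^ 2 - 1)%N
  /\ value_set (SB n) (@length_B n \- @nmaj_B n)
       = value_set [set: 'S_n] (@length_S n \- @maj_S n).
Proof.
have n_gt0 : (0 < n)%N := ltnW hn.
split; last first.
  apply/fsetP => x; apply/imfsetP/imfsetP => -[] /=.
    move=> w Bw ->; have [s ws] := standardization n _ (entry_inj n w).
    exists s; first by rewrite inE.
    rewrite length_nmaj_subE // length_SE maj_SE.
    by rewrite /inv /maj !(winv_entryE n s w).
  move=> s _ ->; have [w [Bw ws _]] := signed_perm_exists n s pred0.
  exists w => //; rewrite length_nmaj_subE // length_SE maj_SE.
  by rewrite /inv /maj !(winv_entryE n s w).
have card_eq ks : uniq ks ->
    (forall k, (exists2 w, w \in SB n & stat_sum n w = k) <-> k \in ks) ->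
    #|` value_set (SB n) (@length_B n \+ @nmaj_B n) |%fset = size ks.
  move=> ks_uniq ksP; apply: card_value_set => // [w Bw | k /ksP[w Bw <-]].
    exists (stat_sum n w); first by apply/ksP; exists w.
    exact: length_nmaj_sumE.
  by exists w => //; apply: length_nmaj_sumE.
case: eqP => [n_eq2 | n_neq2].
  rewrite (card_eq [:: 0; 2; 4; 6; 8]%N) // => k.
  split=> [/(stat_sum_range_dim2 n k n_eq2) | k_in].
    by rewrite !inE; lia.
  by apply/(stat_sum_range_dim2 n k n_eq2); move: k_in; rewrite !inE; lia.
have n_gt2 : (2 < n)%N by lia.
have sq_gt : (2 < n ^ 2)%N by nia.
rewrite (card_eq [:: 0, (2 * n ^ 2) & iota 2 (2 * n ^ 2 - 3)]%N) /= ?size_iota.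
- by lia.
- by rewrite !inE !mem_iota iota_uniq; lia.
move=> k; split=> [/(stat_sum_range n k n_gt2)[] | k_in].
  by rewrite !inE mem_iota; lia.
by apply/(stat_sum_range n k n_gt2); move: k_in; rewrite !inE mem_iota; split; lia.
Qed.
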